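(* Let the stochastic one-step method $(\Psi,\overline{h},\xi)$ be stochastically C-stable (with constants $C_{\mathrm{stab}}$ and $\eta\in(1,\infty)$) and stochastically B-consistent of order $\gamma>0$ (with constant $C_{\mathrm{cons}}$) to the SODE $\mathrm{d}X(t)=f(t,X(t))\,\mathrm{d}t+\sum_{r=1}^m g^r(t,X(t))\,\mathrm{d}W^r(t)$, $t\in[0,T]$, $X(0)=X_0$. If $\xi=X_0$, then there exists a constant $C$ depending on $C_{\mathrm{stab}}$, $C_{\mathrm{cons}}$, $T$, $\overline{h}$ and $\eta$ such that for every $N\in\mathbb{N}$ and every vector of step sizes $h\in(0,\overline{h}]^N$ it holds $$\max_{n\in\{0,\ldots,N\}}\big\|X(t_n)-X_h(t_n)\big\|_{L^2(\Omega;\mathbb{R}^d)}\le C|h|^{\gamma},$$ where $X$ denotes the exact solution to the SODE and $X_h$ the grid function generated by $(\Psi,\overline{h},\xi)$ with step sizes $h$. In particular, $(\Psi,\overline{h},\xi)$ is strongly convergent of order $\gamma$.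
   Context: Let $d,m\in\mathbb{N}$, $T\in(0,\infty)$, and let $(\Omega,\mathcal{F},(\mathcal{F}_t)_{t\in[0,T]},\mathbf{P})$ be a filtered probability space satisfying the usual conditions, with independent real-valued standard $(\mathcal{F}_t)$-Brownian motions $W^1,\ldots,W^m$. $|\cdot|$ and $\langle\cdot,\cdot\rangle$ are the Euclidean norm and inner product; $\|Y\|_{L^p(\Omega;\mathbb{R}^d)}=(\mathbb{E}|Y|^p)^{1/p}$. Standing assumptions on the SODE: $X_0\in L^p(\Omega,\mathcal{F}_0,\mathbf{P};\mathbb{R}^d)$ for a sufficiently large $p\in[2,\infty)$; $f,g^r\colon[0,T]\times\mathbb{R}^d\to\mathbb{R}^d$, $r=1,\ldots,m$, are continuous and there are $L>0$, $\eta_0\in(\frac12,\infty)$, $q\in(1,\infty)$ with, for all $t,t_1,t_2\in[0,T]$, $x,x_1,x_2\in\mathbb{R}^d$ and $r=1,\ldots,m$: $\langle f(t,x_1)-f(t,x_2),x_1-x_2\rangle+\eta_0\sum_{r=1}^m|g^r(t,x_1)-g^r(t,x_2)|^2\le L|x_1-x_2|^2$; $|f(t,x)|\vee|g^r(t,x)|\le L(1+|x|^q)$; $|f(t_1,x)-f(t_2,x)|\vee|g^r(t_1,x)-g^r(t_2,x)|\le L(1+|x|^q)|t_1-t_2|^{1/2}$; $|f(t,x_1)-f(t,x_2)|\vee|g^r(t,x_1)-g^r(t,x_2)|\le L(1+|x_1|^{q-1}+|x_2|^{q-1})|x_1-x_2|$. The exact solution $X$ is the unique almost surely continuous, $(\mathcal{F}_t)$-adapted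 process satisfying the integral form of the SODE $\mathbf{P}$-a.s. for all $t\in[0,T]$. Step sizes: a vector of step sizes is $h=(h_1,\ldots,h_N)\in(0,T]^N$ with $\sum_{i=1}^N h_i=T$; $t_n:=\sum_{i=1}^n h_i$, $\mathcal{T}_h=\{t_0,\ldots,t_N\}$, $|h|:=\max_i h_i$. $\mathcal{G}^2(\mathcal{T}_h)$ is the set of $Z\colon\mathcal{T}_h\times\Omega\to\mathbb{R}^d$ with $Z(t_n)\in L^2(\Omega,\mathcal{F}_{t_n},\mathbf{P};\mathbb{R}^d)$ for all $n=0,\ldots,N$. One-step method: let $\overline{h}\in(0,T]$ and $\mathbb{T}:=\{(t,\delta)\in[0,T)\times(0,\overline{h}]:t+\delta\le T\}$. A stochastic one-step method $(\Psi,\overline{h},\xi)$ consists of $\xi\in L^2(\Omega,\mathcal{F}_0,\mathbf{P};\mathbb{R}^d)$ and a map $\Psi\colon\mathbb{R}^d\times\mathbb{T}\times\Omega\to\mathbb{R}^d$ with $\Psi(Z,t,\delta)\in L^2(\Omega,\mathcal{F}_{t+\delta},\mathbf{P};\mathbb{R}^d)$ for all $(t,\delta)\in\mathbb{T}$, $Z\in L^2(\Omega,\mathcal{F}_t,\mathbf{P};\mathbb{R}^d)$ (here $\Psi(Z,t,\delta)$ is $\omega\mapsto\Psi(Z(\omega),t,\delta,\omega)$). For a vector of step sizes $h\in(0,\overline{h}]^N$ the generated grid function $X_h\in\mathcal{G}^2(\mathcal{T}_h)$ is $X_h(t_0)=\xi$, $X_h(t_i)=\Psi(X_h(t_{i-1}),t_{i-1},h_i)$,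 $1\le i\le N$. Write $(\mathrm{id}-\mathbb{E}[\,\cdot\,|\mathcal{F}_t])Y:=Y-\mathbb{E}[Y|\mathcal{F}_t]$. Stochastically C-stable: there exist a constant $C_{\mathrm{stab}}$ and $\eta\in(1,\infty)$ such that for all $(t,\delta)\in\mathbb{T}$ and $Y,Z\in L^2(\Omega,\mathcal{F}_t,\mathbf{P};\mathbb{R}^d)$: $\|\mathbb{E}[\Psi(Y,t,\delta)-\Psi(Z,t,\delta)|\mathcal{F}_t]\|_{L^2(\Omega;\mathbb{R}^d)}^2+\eta\|(\mathrm{id}-\mathbb{E}[\,\cdot\,|\mathcal{F}_t])(\Psi(Y,t,\delta)-\Psi(Z,t,\delta))\|_{L^2(\Omega;\mathbb{R}^d)}^2\le(1+C_{\mathrm{stab}}\delta)\|Y-Z\|_{L^2(\Omega;\mathbb{R}^d)}^2$. Stochastically B-consistent of order $\gamma>0$: there exists $C_{\mathrm{cons}}$ such that for every $(t,\delta)\in\mathbb{T}$: $\|\mathbb{E}[X(t+\delta)-\Psi(X(t),t,\delta)|\mathcal{F}_t]\|_{L^2(\Omega;\mathbb{R}^d)}\le C_{\mathrm{cons}}\delta^{\gamma+1}$ and $\|(\mathrm{id}-\mathbb{E}[\,\cdot\,|\mathcal{F}_t])(X(t+\delta)-\Psi(X(t),t,\delta))\|_{L^2(\Omega;\mathbb{R}^d)}\le C_{\mathrm{cons}}\delta^{\gamma+\frac12}$. Strongly convergent of order $\gamma>0$: there exists $C$ such that for every vector of step sizes $h\in(0,\overline{h}]^N$, $\max_{n\in\{0,\ldots,N\}}\|X_h(t_n)-X(t_n)\|_{L^2(\Omega;\mathbb{R}^d)}\le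 C|h|^\gamma$. *)

(* Defs.v *)
From HB Require Import structures.
From mathcomp Require Import all_boot all_order all_algebra.
From mathcomp Require Import all_classical all_reals all_analysis.

Set Implicit Arguments.
Unset Strict Implicit.
Unset Printing Implicit Defensive.

Import Order.TTheory GRing.Theory Num.Theory.
Import numFieldNormedType.Exports.

Local Open Scope classical_set_scope.
Local Open Scope ring_scope.

Section Euclidean.
Context (R : realType) (d : nat).

(* The library norm on ['rV[R]_d] is the sup norm, hence these definitions. *)
Definition dot (x y : 'rV[R]_d) : R := \sum_(i < d) x 0 i * y 0 i.
Definition enorm (x : 'rV[R]_d) : R := Num.sqrt (dot x x).

End Euclidean.

Section RandomVectors.
Context (R : realType) (disp : measure_display) (Omega : measurableType disp)
        (P : probability Omega R).

Definition measurable_wrt (G : set (set Omega)) (Y : Omega -> R) : Prop :=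
  forall B : set R, measurable B -> G (Y @^-1` B).

Definition measurable_wrtV d (G : set (set Omega)) (Y : Omega -> 'rV[R]_d) :=
  forall i, measurable_wrt G (fun w => Y w 0 i).

Definition normLp d (p : R) (Y : Omega -> 'rV[R]_d) : \bar R :=
  Lnorm P p%:E (fun w => (enorm (Y w))%:E).

Definition inLp d (p : R) (G : set (set Omega)) (Y : Omega -> 'rV[R]_d) :=
  measurable_wrtV G Y /\ (normLp p Y < +oo)%E.

Definition is_cond_exp (G : set (set Omega)) (Y Z : Omega -> R) : Prop :=
  [/\ P.-integrable setT (EFin \o Y),
      P.-integrable setT (EFin \o Z),
      measurable_wrt G Z &
      forall A, G A ->
        (\int[P]_(w in A) (Z w)%:E = \int[P]_(w in A) (Y w)%:E)%E].

(* A version of E[Y | G]; the junk value 0 is used if Y is not integrable. *)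
Definition cond_exp1 (G : set (set Omega)) (Y : Omega -> R) : Omega -> R :=
  xget (fun=> 0) [set Z | is_cond_exp G Y Z].

Definition cond_exp d (G : set (set Omega)) (Y : Omega -> 'rV[R]_d) :
    Omega -> 'rV[R]_d :=
  fun w => \row_i cond_exp1 G (fun w' => Y w' 0 i) w.

Definition id_sub_cond_exp d (G : set (set Omega)) (Y : Omega -> 'rV[R]_d) :
    Omega -> 'rV[R]_d :=
  fun w => Y w - cond_exp G Y w.

(* Mutual independence of a finite family of systems of events. *)
Definition mutually_independent (m : nat) (G : 'I_m -> set (set Omega)) :=
  forall (J : {set 'I_m}) (A : 'I_m -> set Omega),
    (forall r, r \in J -> G r (A r)) ->
    (P (\big[setI/setT]_(r in J) A r) = \prod_(r in J) P (A r))%E.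

End RandomVectors.

Section Stochastic.
Context (R : realType) (disp : measure_display) (Omega : measurableType disp)
        (P : probability Omega R).
(* Only the values of [F] on [0, T] matter. *)
Context (T : R) (F : R -> set (set Omega)).

Definition usual_conditions : Prop :=
  [/\ forall t : R, t \in `[0, T] -> sigma_algebra setT (F t) /\ F t `<=` measurable,
      forall s t : R, 0 <= s -> s <= t -> t <= T -> F s `<=` F t,
      forall t : R, t \in `[0, T[ ->
        F t = [set A | forall s : R, s \in `]t, T] -> F s A],
      measure_is_complete P &
      forall A, P.-negligible A -> F 0 A].

Definition adapted (Y : R -> Omega -> R) : Prop :=
  forall t : R, t \in `[0, T] -> measurable_wrt (F t) (Y t).

Definition as_continuous (Y : R -> Omega -> R) : Prop :=
  {ae P, forall w, {within `[0, T], continuous (fun t => Y t w)}}.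

Definition increment (W : R -> Omega -> R) (s t : R) : Omega -> R :=
  fun w => W t w - W s w.

(* [normal_prob] takes the standard deviation as its second parameter. *)
Definition brownian_motion (W : R -> Omega -> R) : Prop :=
  [/\ adapted W,
      as_continuous W,
      {ae P, forall w, W 0 w = 0},
      forall s t : R, 0 <= s -> s < t -> t <= T ->
        forall B : set R, measurable B ->
          P (increment W s t @^-1` B) =
          normal_prob 0 (Num.sqrt (t - s)) B &
      forall s t : R, 0 <= s -> s < t -> t <= T ->
        forall (A : set Omega) (B : set R), F s A -> measurable B ->
          (P (A `&` increment W s t @^-1` B) =
           P A * P (increment W s t @^-1` B))%E].

Definition sigma_of_process (Y : R -> Omega -> R) : set (set Omega) :=
  <<s [set A | exists (t : R) (B : set R),
         [/\ t \in `[0, T], measurable B & A = Y t @^-1` B]] >>.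

Definition independent_brownian_motions (m : nat)
    (W : 'I_m -> R -> Omega -> R) : Prop :=
  (forall r, brownian_motion (W r)) /\
  mutually_independent P (fun r => sigma_of_process (W r)).

(* The simple process sum_(j < sp_size) sp_coef j * 1_(]sp_time j, sp_time j.+1]) *)
Record simple_process := SimpleProcess {
  sp_size : nat;
  sp_time : nat -> R;
  sp_coef : nat -> Omega -> R }.

Definition is_simple (H : simple_process) : Prop :=
  [/\ 0 <= sp_time H 0,
      forall j, (j < sp_size H)%N -> sp_time H j <= sp_time H j.+1,
      sp_time H (sp_size H) <= T &
      forall j, (j < sp_size H)%N ->
        measurable_wrt (F (sp_time H j)) (sp_coef H j) /\
        exists M : R, forall w, `|sp_coef H j w| <= M].

Definition sp_val (H : simple_process) (t : R) (w : Omega) : R :=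
  \sum_(j < sp_size H)
     sp_coef H j w * (sp_time H j < t <= sp_time H j.+1)%R%:R.

Definition sp_integral (H : simple_process) (W : R -> Omega -> R)
    (t : R) (w : Omega) : R :=
  \sum_(j < sp_size H) sp_coef H j w *
     (W (Num.min (sp_time H j.+1) t) w - W (Num.min (sp_time H j) t) w).

Definition sp_error (H : simple_process) (G : R -> Omega -> R) (w : Omega) :
    \bar R :=
  (\int[lebesgue_measure]_(s in `[0%R, T]) ((sp_val H s w - G s w) ^+ 2)%:E)%E.

(* [I] is the (continuous) Ito integral process t |-> int_0^t G dW: simple
   integrands approximate G in L^2([0, T]) in probability and their elementary
   integrals converge to I in probability. *)
Definition ito_integral (W G I : R -> Omega -> R) : Prop :=
  [/\ adapted I,
      as_continuous I &
      exists H : nat -> simple_process,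
        [/\ forall n, is_simple (H n),
            forall e : R, 0 < e ->
              P [set w | (e%:E <= sp_error (H n) G w)%E]
                @[n --> \oo] --> 0%E &
            forall t : R, t \in `[0, T] -> forall e : R, 0 < e ->
              P [set w | e <= `|sp_integral (H n) W t w - I t w|]
                @[n --> \oo] --> 0%E]].

Context (d m : nat).
Implicit Types (f : R -> 'rV[R]_d -> 'rV[R]_d)
               (g : 'I_m -> R -> 'rV[R]_d -> 'rV[R]_d).

Definition jointly_continuous f : Prop :=
  {within [set z : R * 'rV[R]_d | 0 <= z.1 <= T],
     continuous (fun z : R * 'rV[R]_d => f z.1 z.2)}.

Definition growth_bound f (L q : R) : Prop :=
  forall (t : R) x, t \in `[0, T] -> enorm (f t x) <= L * (1 + enorm x `^ q).

Definition time_hoelder f (L q : R) : Prop :=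
  forall (t1 t2 : R) x, t1 \in `[0, T] -> t2 \in `[0, T] ->
    enorm (f t1 x - f t2 x) <= L * (1 + enorm x `^ q) * `|t1 - t2| `^ 2^-1.

Definition local_lipschitz f (L q : R) : Prop :=
  forall (t : R) x1 x2, t \in `[0, T] ->
    enorm (f t x1 - f t x2) <=
    L * (1 + enorm x1 `^ (q - 1) + enorm x2 `^ (q - 1)) * enorm (x1 - x2).

Definition global_monotonicity f g (L eta0 : R) : Prop :=
  forall (t : R) x1 x2, t \in `[0, T] ->
    dot (f t x1 - f t x2) (x1 - x2)
      + eta0 * \sum_(r < m) enorm (g r t x1 - g r t x2) ^+ 2
    <= L * enorm (x1 - x2) ^+ 2.

Definition sode_coefficients f g : Prop :=
  (jointly_continuous f /\ forall r, jointly_continuous (g r)) /\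
  exists L eta0 q : R,
    [/\ 0 < L, 2^-1 < eta0 & 1 < q] /\
    [/\ global_monotonicity f g L eta0,
        growth_bound f L q /\ (forall r, growth_bound (g r) L q),
        time_hoelder f L q /\ (forall r, time_hoelder (g r) L q) &
        local_lipschitz f L q /\ (forall r, local_lipschitz (g r) L q)].

Definition exact_solution (W : 'I_m -> R -> Omega -> R) f g
    (X0 : Omega -> 'rV[R]_d) (X : R -> Omega -> 'rV[R]_d) : Prop :=
  [/\ forall i, adapted (fun t w => X t w 0 i),
      forall i, as_continuous (fun t w => X t w 0 i) &
      exists I : 'I_m -> 'I_d -> R -> Omega -> R,
        (forall r i, ito_integral (W r) (fun s w => g r s (X s w) 0 i) (I r i)) /\
        {ae P, forall w, forall t : R, t \in `[0, T] -> forall i,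
           X t w 0 i = X0 w 0 i
             + \int[lebesgue_measure]_(s in `[0, t]) (f s (X s w) 0 i)
             + \sum_(r < m) I r i t w}].

(* [Psi] is total; only its values at [admissible] (t, delta)
   matter. *)
Implicit Types (Psi : 'rV[R]_d -> R -> R -> Omega -> 'rV[R]_d)
               (xi : Omega -> 'rV[R]_d).

Definition admissible (hbar t delta : R) : Prop :=
  [/\ 0 <= t < T, 0 < delta <= hbar & t + delta <= T].

Definition one_step Psi (Z : Omega -> 'rV[R]_d) (t delta : R) :
    Omega -> 'rV[R]_d :=
  fun w => Psi (Z w) t delta w.

Definition one_step_method Psi (hbar : R) xi : Prop :=
  inLp P 2 (F 0) xi /\
  forall (t delta : R) Z, admissible hbar t delta -> inLp P 2 (F t) Z ->
    inLp P 2 (F (t + delta)) (one_step Psi Z t delta).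

Definition C_stable Psi (hbar Cstab eta : R) : Prop :=
  forall (t delta : R) Y Z, admissible hbar t delta ->
    inLp P 2 (F t) Y -> inLp P 2 (F t) Z ->
    let D := fun w => one_step Psi Y t delta w - one_step Psi Z t delta w in
    (normLp P 2 (cond_exp P (F t) D) ^+ 2
       + eta%:E * normLp P 2 (id_sub_cond_exp P (F t) D) ^+ 2
     <= (1 + Cstab * delta)%:E * normLp P 2 (fun w => Y w - Z w)%R ^+ 2)%E.

(* If the local error D failed to be integrable, its [cond_exp] would be junk,
   but then [id_sub_cond_exp D] has infinite L^2-norm and the second bound
   fails. *)
Definition B_consistent Psi (hbar : R) (X : R -> Omega -> 'rV[R]_d)
    (gamma Ccons : R) : Prop :=
  forall t delta : R, admissible hbar t delta ->
    let D := fun w => X (t + delta) w - one_step Psi (X t) t delta w in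
    (normLp P 2 (cond_exp P (F t) D)
       <= (Ccons * delta `^ (gamma + 1))%:E)%E /\
    (normLp P 2 (id_sub_cond_exp P (F t) D)
       <= (Ccons * delta `^ (gamma + 2^-1))%:E)%E.

Definition step_sizes (hbar : R) (N : nat) (h : N.-tuple R) : Prop :=
  (forall i : 'I_N, 0 < tnth h i <= hbar) /\ \sum_(i < N) tnth h i = T.

Definition grid_point (h : seq R) (n : nat) : R := \sum_(i < n) h`_i.

Definition max_step (N : nat) (h : N.-tuple R) : R :=
  \big[Num.max/0]_(i < N) tnth h i.

(* [grid_function Psi xi h n] is X_h(t_n); steps are 0-indexed here: h_n is
   [h`_n.-1]. *)
Fixpoint grid_function Psi xi (h : seq R) (n : nat) : Omega -> 'rV[R]_d :=
  match n with
  | 0 => xi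
  | k.+1 => one_step Psi (grid_function Psi xi h k) (grid_point h k) h`_k
  end.

Definition strongly_convergent Psi (hbar : R) xi
    (X : R -> Omega -> 'rV[R]_d) (gamma : R) : Prop :=
  exists C : R, forall (N : nat) (h : N.-tuple R), step_sizes hbar h ->
    (\big[maxe/-oo]_(n < N.+1)
       normLp P 2 (fun w =>
         grid_function Psi xi h n w - X (grid_point h n) w)%R
     <= (C * max_step h `^ gamma)%:E)%E.

End Stochastic.

(* Main.v *)
Require Import Defs.
From HB Require Import structures.
From mathcomp Require Import all_boot all_order all_algebra.
From mathcomp Require Import all_classical all_reals all_analysis.
From mathcomp Require Import finmap measurable_realfun.
From mathcomp Require Import ring lra.

(** Let [e_n = X(t_n) - X_h(t_n)]. Over one step of size [h_n] the new error is
    [D + S], where [D = X(t_n + h_n) - Psi(X(t_n))] is the local error and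
    [S = Psi(X(t_n)) - Psi(X_h(t_n))] the propagated one. Conditioning on the
    sigma-algebra [F_n] at time [t_n] splits [D + S] into its conditional mean and
    the orthogonal fluctuation around it ([pythagoras]). Young's inequality,
    applied to these two parts with the weights [h_n] and [eta - 1]
    ([error_split]), gives

      [|e_(n+1)|^2 <= (1 + h_n) |E[S|F_n]|^2 + eta |S - E[S|F_n]|^2]
      [               + (1 + 1/h_n) |E[D|F_n]|^2 + eta/(eta-1) |D - E[D|F_n]|^2].

    C-stability bounds the terms in [S] by [(1 + h_n)(1 + |Cstab| h_n) |e_n|^2].
    B-consistency bounds those in [D] by [K h_n h_n^(2 gamma)]: the loss of [1/h_n]
    on the mean is compensated by its additional half order. This is [local_step].
    As [e_0 = 0], Gronwall's argument ([error_recursion]) yields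
    [|e_n|^2 <= K exp(c T) T |h|^(2 gamma)] with [K] and [c] depending only on the
    constants in the theorem; in particular not on [gamma].

    Three points need an argument of their own. The conditional expectations must
    exist for [pythagoras] to apply: they are Radon-Nikodym densities on the coarser
    measurable space ([is_cond_exp_exists]). C-stability may be applied to [X(t_n)]
    only if this variable is square integrable: B-consistency propagates this
    property from one grid point to the next. Finally, the exact solution starts at [X0] because the stochastic
    integrals vanish at time 0 ([exact_solution0]). *)

Set Implicit Arguments.
Unset Strict Implicit.
Unset Printing Implicit Defensive.

Import Order.TTheory GRing.Theory Num.Theory.
Import numFieldNormedType.Exports.
Local Open Scope classical_set_scope.
Local Open Scope ring_scope.

(** * Conditional expectation with respect to a sub-sigma-algebra *)

Section conditional_expectation.
Context (R : realType) (disp : measure_display) (Omega : measurableType disp)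
        (P : probability Omega R) (G : set (set Omega)).
Hypothesis sG : sigma_algebra setT G.
Hypothesis GM : G `<=` measurable.

Lemma measurable_wrtP (Y : Omega -> R) :
  measurable_wrt G Y <->
  measurable_fun [set: g_sigma_algebraType G] (Y : g_sigma_algebraType G -> R).
Proof.
split=> [mY _ B mB|mY B mB].
  by rewrite setTI measurable_g_measurableTypeE//; exact: mY.
have := mY measurableT B mB.
by rewrite setTI measurable_g_measurableTypeE.
Qed.

Lemma measurable_wrt_fun (Y : Omega -> R) :
  measurable_wrt G Y -> measurable_fun setT Y.
Proof. by move=> mY _ B mB; rewrite setTI; apply: GM; exact: mY. Qed.

(** Pushing a measure forward along this map restricts it to [G]. *)
Let coarsen : Omega -> g_sigma_algebraType G := fun x => x.

Let measurable_coarsen : measurable_fun setT coarsen.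
Proof.
move=> _ B; rewrite setTI measurable_g_measurableTypeE// => GB.
exact: GM.
Qed.

HB.instance Definition _ :=
  isMeasurableFun.Build _ _ _ _ coarsen measurable_coarsen.

(** Radon-Nikodym on the coarser space [(Omega, G)]: the charge
    [A |-> \int_A Y dP], restricted to [G], is absolutely continuous with
    respect to the restriction of [P], and its density is [G]-measurable because
    it is a density on that space. *)
Lemma is_cond_exp_exists (Y : Omega -> R) :
  P.-integrable setT (EFin \o Y) -> exists Z, is_cond_exp P G Y Z.
Proof.
move=> iY.
pose nu := measure_function_pushforward__canonical__charge_Charge
  (induced_charge iY) measurable_coarsen.
pose mu := distribution P coarsen.
have numu : nu `<< mu.
  apply/null_content_dominatesP => A mA muA0 /=.
  have mA' : measurable (coarsen @^-1` A).
    by rewrite -[X in measurable X]setTI; exact: measurable_coarsen.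
  apply: (null_set_integral (mu := P) mA' _ muA0).
  by apply: (measurable_funS measurableT) => //; exact: measurable_int iY.
pose f : g_sigma_algebraType G -> \bar R := Radon_Nikodym nu mu.
have ffin w : f w \is a fin_num by exact: Radon_Nikodym_fin_num.
have jf : mu.-integrable setT f by exact: Radon_Nikodym_integrable.
have mf := measurable_int _ jf.
have fE : EFin \o (fine \o f) = f by apply/funext => w /=; rewrite fineK.
have if_ : P.-integrable setT (f \o coarsen).
  apply/integrableP; split; first exact: measurableT_comp mf measurable_coarsen.
  have /integrableP[_] := jf.
  rewrite ge0_integral_pushforward //.
  exact: measurableT_comp.
exists (fine \o f); split => //.
- by rewrite fE.
- by apply/measurable_wrtP; exact: measurableT_comp mf.
- move=> A GA.
  have mA : measurable (A : set (g_sigma_algebraType G)).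
    by rewrite measurable_g_measurableTypeE.
  have nuE : (\int[P]_(w in A) (Y w)%:E = \int[mu]_(w in A) f w)%E.
    exact: (Radon_Nikodym_integral numu mA).
  rewrite nuE [RHS]integral_pushforward //.
  - by apply: eq_integral => w _; rewrite /= fineK.
  - by apply: (integrableS measurableT _ _ if_) => //; exact: GM.
Qed.

Import HBNNSimple.

(** The hypothesis on [b] says that [b] integrates to 0 against indicators of
    [G]-sets, hence against [G]-measurable simple functions. These increase to
    [a], and [a |b|] dominates their products with [b]. *)
Lemma ge0_integral_mul_wrt (a b : Omega -> R) :
  measurable_wrt G a -> (forall w, 0 <= a w) ->
  P.-integrable setT (EFin \o b) ->
  P.-integrable setT (EFin \o (a \* b)) ->
  (forall A, G A -> (\int[P]_(w in A) (b w)%:E = 0)%E) ->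
  (\int[P]_w (a w * b w)%:E = 0)%E.
Proof.
move=> ma a0 ib iab b0.
have ma' : measurable_fun [set: g_sigma_algebraType G] (EFin \o a).
  by apply/measurable_EFinP; apply/measurable_wrtP.
pose f n := nnsfun_approx measurableT ma' n.
have mf n : measurable_wrt G (f n : Omega -> R).
  apply/measurable_wrtP; exact: measurable_funP.
have mb : measurable_fun setT b.
  by apply/measurable_EFinP; exact: measurable_int ib.
have f0 n w : 0 <= f n w by [].
have fle n w : f n w <= a w.
  rewrite /f nnsfun_approxE -lee_fin.
  by apply: (le_approx (f := EFin \o a)) => // x _; rewrite lee_fin.
have f_int n : (\int[P]_w (f n w * b w)%:E = 0)%E.
  have fin_f : finite_set (range (f n)) by [].
  transitivity (\int[P]_w \sum_(y <- fset_set (range (f n)))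
      ((y * \1_(f n @^-1` [set y]) w) * b w)%:E)%E.
    apply: eq_integral => w _.
    by rewrite (fimfunE (f n) w) fsbig_finite//= sumEFin -mulr_suml.
  have mfy y : measurable (f n @^-1` [set y] : set Omega).
    by apply: GM; exact: mf.
  have fyE y w : ((y * \1_(f n @^-1` [set y]) w) * b w)%:E =
      (y%:E * ((EFin \o b) \_ (f n @^-1` [set y])) w)%E.
    by rewrite epatch_indic/= -mulrA [\1__ w * _]mulrC EFinM.
  have iby y : P.-integrable setT ((EFin \o b) \_ (f n @^-1` [set y])).
    apply/(integrable_mkcond _ (mfy y)).
    exact: (integrableS measurableT (mfy y) _ ib).
  under eq_integral do under eq_bigr do rewrite fyE.
  rewrite integral_sum //; last first.
    by move=> y; exact: integrableZl.
  rewrite big1 // => y _.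
  rewrite integralZl // -integral_mkcond b0 ?mule0 //.
  exact: mf.
have cf : [sequence (\int[P]_w (f n w * b w)%:E)%E]_n @ \oo -->
    (\int[P]_w (a w * b w)%:E)%E.
  have [] // := @dominated_convergence _ _ _ P setT measurableT
    (fun n w => (f n w * b w)%:E) (EFin \o (a \* b))
    (abse \o (EFin \o (a \* b))).
  - move=> n; apply/measurable_EFinP; apply: measurable_funM => //.
    by apply: measurable_wrt_fun; exact: mf.
  - exact: measurable_int iab.
  - apply/aeW => w _.
    have -> : (fun n => (f n w * b w)%:E) =
        (fun n => ((f n w)%:E * (b w)%:E)%E).
      by apply/funext => n; rewrite EFinM.
    rewrite [(EFin \o _) w]EFinM; apply: cvgeZr => //.
    apply: (cvg_nnsfun_approx measurableT ma') => // x _.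
    by rewrite lee_fin.
  - exact: integrable_abse.
  - apply/aeW => w n _ /=; rewrite lee_fin !normrM ler_wpM2r //.
    by rewrite !ger0_norm.
apply: cvg_unique cf _ => //.
rewrite (_ : [sequence _]_n = cst 0%E); first exact: cvg_cst.
by apply/funext => n /=; rewrite f_int.
Qed.

End conditional_expectation.

(** * Square integrable random vectors *)

Section square_integrable.
Context (R : realType) (disp : measure_display) (Omega : measurableType disp)
        (P : probability Omega R).

Lemma Lfun2P (f : Omega -> R) : f \in Lfun P 2%:E <->
  measurable_fun setT f /\ (\int[P]_w (f w ^+ 2)%:E < +oo)%E.
Proof.
have E : Lnorm P 2%:E (EFin \o f) = ((\int[P]_w (f w ^+ 2)%:E) `^ 2^-1)%E.
  rewrite unlock; congr (_ `^ _)%E; apply: eq_integral => w _ /=.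
  by rewrite powR_mulrn// real_normK ?num_real.
split=> [hf|[mf f2]].
  split; first exact: set_mem (sub_Lfun_mfun hf).
  have := set_mem (sub_Lfun_finLfun hf).
  rewrite /= /finite_norm E => /lty_poweRy.
  by rewrite invr_eq0 pnatr_eq0 => /(_ isT).
apply/andP; split; apply/mem_set => //.
by rewrite /= /finite_norm E; exact: poweR_lty.
Qed.

Lemma Lfun2D (f g : Omega -> R) : f \in Lfun P 2%:E -> g \in Lfun P 2%:E ->
  (fun w => f w + g w) \in Lfun P 2%:E.
Proof. exact: (Lfun_addr_closed _ (lee1n 2)).2. Qed.

Lemma Lfun2B (f g : Omega -> R) : f \in Lfun P 2%:E -> g \in Lfun P 2%:E ->
  (fun w => f w - g w) \in Lfun P 2%:E.
Proof.
move=> hf hg; apply: Lfun2D => //.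
exact: Lfun_oppr_closed hg.
Qed.

Lemma integral_EFin_Rintegral (f : Omega -> R) :
  P.-integrable setT (EFin \o f) ->
  (\int[P]_w (f w)%:E = (\int[P]_w f w)%R%:E)%E.
Proof. by move=> fi; rewrite /Rintegral fineK//; exact: integrable_fin_num. Qed.

Lemma Lfun2_mul (f g : Omega -> R) : f \in Lfun P 2%:E -> g \in Lfun P 2%:E ->
  P.-integrable setT (EFin \o (f \* g)).
Proof. by move=> hf hg; apply/Lfun1_integrable; exact: Lfun2_mul_Lfun1. Qed.

Lemma Lfun2_integrable1 (f : Omega -> R) : f \in Lfun P 2%:E ->
  P.-integrable setT (EFin \o f).
Proof.
move=> hf; apply/Lfun1_integrable; apply: Lfun_subset12 => //.
exact: fin_num_measure.
Qed.

(** C-stability only bounds a weighted sum of two extended reals; this extracts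
    the finiteness of each conditional norm, which must be known before the
    norms can be treated as reals. *)
Lemma lty_of_sum_sqr (x y : \bar R) (a r : R) :
  0 < a -> (0 <= x)%E -> (0 <= y)%E ->
  (x ^+ 2 + a%:E * y ^+ 2 <= r%:E)%E -> (x < +oo)%E /\ (y < +oo)%E.
Proof.
move=> a0 x0 y0; have ay : (0 <= a%:E * y ^+ 2)%E.
  by apply: mule_ge0; [rewrite lee_fin ltW | exact: expe_ge0].
have ax : (0 <= x ^+ 2)%E by rewrite expe_ge0.
move=> xy; split.
- have : (x ^+ 2 <= r%:E)%E by apply: le_trans xy; rewrite leeDl.
  move: x0 {ax xy}; by case: x => [x| |] // _; rewrite ?ltry.
- have : (a%:E * y ^+ 2 <= r%:E)%E by apply: le_trans xy; rewrite leeDr.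
  move: y0 {ay xy}; case: y => [y| |] // _; rewrite ?ltry //.
  by rewrite gt0_muley ?lte_fin // leye_eq.
Qed.

Context (d : nat).
Implicit Types (X Y Z : Omega -> 'rV[R]_d) (x y : 'rV[R]_d).

Definition sq_integrable Y := forall i, (fun w => Y w 0 i) \in Lfun P 2%:E.

Definition l2_inner X Y : R := \int[P]_w dot (X w) (Y w).

Lemma dot_ge0 x : 0 <= dot x x.
Proof. by apply: sumr_ge0 => i _; rewrite -expr2 sqr_ge0. Qed.

Lemma enorm_sqr x : enorm x ^+ 2 = dot x x.
Proof. by rewrite /enorm sqr_sqrtr // dot_ge0. Qed.

Lemma normLp2E Y : normLp P 2 Y = ((\int[P]_w (dot (Y w) (Y w))%:E) `^ 2^-1)%E.
Proof.
rewrite /normLp unlock; congr (_ `^ _)%E; apply: eq_integral => w _ /=.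
by rewrite powR_mulrn// real_normK ?num_real// enorm_sqr.
Qed.

Lemma dot_integrable X Y : sq_integrable X -> sq_integrable Y ->
  P.-integrable setT (EFin \o (fun w => dot (X w) (Y w))).
Proof.
move=> hX hY.
have -> : EFin \o (fun w => dot (X w) (Y w)) =
    (fun w => \sum_(i < d) (X w 0 i * Y w 0 i)%:E)%E.
  by apply/funext => w /=; rewrite sumEFin.
by apply: integrable_sum => // i _; exact: Lfun2_mul.
Qed.

Lemma normLp2_l2_inner Y :
  sq_integrable Y -> normLp P 2 Y = (Num.sqrt (l2_inner Y Y))%:E.
Proof.
move=> hY; rewrite normLp2E integral_EFin_Rintegral; last exact: dot_integrable.
rewrite poweR12_sqrt // lee_fin; apply: Rintegral_ge0 => w _; exact: dot_ge0.
Qed.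

Lemma l2_inner_ge0 Y : 0 <= l2_inner Y Y.
Proof. by apply: Rintegral_ge0 => w _; exact: dot_ge0. Qed.

Lemma finite_norm_sq_integrable Y :
  (forall i, measurable_fun setT (fun w => Y w 0 i)) ->
  (normLp P 2 Y < +oo)%E -> sq_integrable Y.
Proof.
move=> mY; rewrite normLp2E => /lty_poweRy.
rewrite invr_eq0 pnatr_eq0 => /(_ isT) dY.
move=> i; apply/Lfun2P; split => //; apply: le_lt_trans dY.
apply: ge0_le_integral => //.
- by move=> w _; rewrite lee_fin sqr_ge0.
- by apply/measurable_EFinP; exact: measurable_funX.
- apply/measurable_EFinP.
  by apply: measurable_sum => j; exact: measurable_funM.
- move=> w _; rewrite lee_fin /dot (bigD1 i)//= -expr2 lerDl.
  by apply: sumr_ge0 => j _; rewrite -expr2 sqr_ge0.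
Qed.

Lemma sq_integrableD X Y : sq_integrable X -> sq_integrable Y ->
  sq_integrable (fun w => X w + Y w).
Proof.
move=> hX hY i; rewrite (_ : (fun _ => _) = fun w => X w 0 i + Y w 0 i).
  exact: Lfun2D.
by apply/funext => w; rewrite mxE.
Qed.

Lemma sq_integrableB X Y : sq_integrable X -> sq_integrable Y ->
  sq_integrable (fun w => X w - Y w).
Proof.
move=> hX hY i; rewrite (_ : (fun _ => _) = fun w => X w 0 i - Y w 0 i).
  exact: Lfun2B.
by apply/funext => w; rewrite !mxE.
Qed.

(** Pointwise, [(1 + e) |x|^2 + (1 + 1/e) |y|^2 - |x + y|^2 = |e x - y|^2 / e]. *)
Lemma l2_inner_Young X Y (e : R) :
  0 < e -> sq_integrable X -> sq_integrable Y ->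
  l2_inner (fun w => X w + Y w) (fun w => X w + Y w) <=
  (1 + e) * l2_inner X X + (1 + e^-1) * l2_inner Y Y.
Proof.
move=> e0 hX hY; have iX := dot_integrable hX hX.
have iY := dot_integrable hY hY.
rewrite /l2_inner -!RintegralZl // -RintegralD //; last 2 first.
- exact: (integrableZl _ (1 + e) iX).
- exact: (integrableZl _ (1 + e^-1) iY).
apply: le_Rintegral => //.
- by apply: dot_integrable; exact: sq_integrableD.
- exact: (integrableD measurableT (integrableZl measurableT (1 + e) iX)
    (integrableZl measurableT (1 + e^-1) iY)).
move=> w _; rewrite /dot !mulr_sumr -big_split/=; apply: ler_sum => i _.
rewrite mxE; set x := X w 0 i; set y := Y w 0 i.
rewrite -subr_ge0.
have -> : (1 + e) * (x * x) + (1 + e^-1) * (y * y) - (x + y) * (x + y) =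
  e^-1 * (e * x - y) ^+ 2 by field; rewrite gt_eqF.
by rewrite mulr_ge0 ?sqr_ge0 // invr_ge0 ltW.
Qed.

Lemma inLp2_sq_integrable (G : set (set Omega)) Y :
  G `<=` measurable -> inLp P 2 G Y -> sq_integrable Y.
Proof.
move=> GM [mY Yoo]; apply: finite_norm_sq_integrable => // i.
exact: (measurable_wrt_fun GM (mY i)).
Qed.

Lemma sq_integrable_inLp2 (G : set (set Omega)) Y :
  measurable_wrtV G Y -> sq_integrable Y -> inLp P 2 G Y.
Proof. by move=> mY hY; split=> //; rewrite normLp2_l2_inner // ltry. Qed.

Lemma normLp2_sqr Y : sq_integrable Y ->
  (normLp P 2 Y ^+ 2)%E = (l2_inner Y Y)%:E.
Proof.
by move=> hY; rewrite normLp2_l2_inner // -EFin_expe sqr_sqrtr // l2_inner_ge0.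
Qed.

Lemma ae_eq_normLp2 X Y :
  (forall i, measurable_fun setT (fun w => X w 0 i)) ->
  (forall i, measurable_fun setT (fun w => Y w 0 i)) ->
  {ae P, forall w, X w = Y w} -> normLp P 2 X = normLp P 2 Y.
Proof.
move=> mX mY XY; rewrite !normLp2E; congr (_ `^ _)%E.
have mdot Z : (forall i, measurable_fun setT (fun w => Z w 0 i)) ->
    measurable_fun setT (fun w => (dot (Z w) (Z w))%:E).
  move=> mZ; apply/measurable_EFinP.
  by apply: measurable_sum => i; exact: measurable_funM.
apply: ge0_ae_eq_integral => //; try exact: mdot.
- by move=> w _; rewrite lee_fin dot_ge0.
- by move=> w _; rewrite lee_fin dot_ge0.
- by apply: filterS XY => w -> .
Qed.

Lemma normLp2_distrC X Y :
  normLp P 2 (fun w => X w - Y w) = normLp P 2 (fun w => Y w - X w).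
Proof.
rewrite !normLp2E; congr (_ `^ _)%E; apply: eq_integral => w _.
by congr EFin; apply: eq_bigr => i _; rewrite !mxE; ring.
Qed.

Lemma normLp2_le Y (a : R) : sq_integrable Y ->
  (normLp P 2 Y <= a%:E)%E -> l2_inner Y Y <= a ^+ 2.
Proof.
move=> hY; rewrite normLp2_l2_inner // lee_fin => Ya.
rewrite -[leLHS]sqr_sqrtr ?l2_inner_ge0 //.
by rewrite lerXn2r // nnegrE ?sqrtr_ge0 // (le_trans _ Ya) ?sqrtr_ge0.
Qed.

End square_integrable.

(** * Orthogonality of conditional mean and fluctuation *)

Section orthogonality.
Context (R : realType) (disp : measure_display) (Omega : measurableType disp)
        (P : probability Omega R) (G : set (set Omega)).
Hypothesis sG : sigma_algebra setT G.
Hypothesis GM : G `<=` measurable.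

(** A function with zero integral on all [G]-sets is orthogonal to
    [L^2(Omega, G, P)]: split [a] into its positive and negative parts. *)
Lemma integral_mul_wrt (a b : Omega -> R) :
  measurable_wrt G a -> a \in Lfun P 2%:E -> b \in Lfun P 2%:E ->
  (forall A, G A -> (\int[P]_(w in A) (b w)%:E = 0)%E) ->
  \int[P]_w (a w * b w) = 0.
Proof.
move=> ma a2 b2 b0.
have pos (c : Omega -> R) : measurable_wrt G c -> c \in Lfun P 2%:E ->
    P.-integrable setT (EFin \o ((fun w => Num.max (c w) 0) \* b)) /\
    \int[P]_w (Num.max (c w) 0 * b w) = 0.
  move=> mc c2.
  have mm : measurable_wrt G (fun w => Num.max (c w) 0).
    apply/measurable_wrtP => //; apply: measurable_maxr => //.
    exact/measurable_wrtP.
  have m2 : (fun w => Num.max (c w) 0) \in Lfun P 2%:E.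
    have /Lfun2P[_ c2oo] := c2.
    have mm' := measurable_wrt_fun GM mm; have mc' := measurable_wrt_fun GM mc.
    apply/Lfun2P; split=> //; apply: le_lt_trans c2oo.
    apply: ge0_le_integral => //.
    - by move=> w _; rewrite lee_fin sqr_ge0.
    - by apply/measurable_EFinP; exact: measurable_funX.
    - by apply/measurable_EFinP; exact: measurable_funX.
    - move=> w _; rewrite lee_fin; case: (leP (c w) 0) => // _.
      by rewrite expr0n sqr_ge0.
  have mb := Lfun2_mul m2 b2; split => //.
  rewrite /Rintegral (ge0_integral_mul_wrt sG GM mm _ (Lfun2_integrable1 b2)) //.
  by move=> w; rewrite le_max lexx orbT.
have mNa : measurable_wrt G (fun w => - a w).
  apply/measurable_wrtP => //; apply: measurable_funN.
  exact/measurable_wrtP.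
have [i1 e1] := pos _ ma a2.
have [i2 e2] := pos _ mNa (Lfun_oppr_closed a2).
under eq_Rintegral.
  move=> w _.
  have -> : a w * b w = Num.max (a w) 0 * b w - Num.max (- a w) 0 * b w.
    rewrite -mulrBl; congr (_ * _).
    by case: (leP (a w) 0); case: (leP (- a w) 0); lra.
  over.
by rewrite RintegralB // e1 e2 subr0.
Qed.

Lemma cond_exp1P (Y : Omega -> R) : P.-integrable setT (EFin \o Y) ->
  is_cond_exp P G Y (cond_exp1 P G Y).
Proof.
move=> /(is_cond_exp_exists sG GM)[Z hZ].
exact: (xgetPex _ (ex_intro _ Z hZ)).
Qed.

(** For a non-integrable [Y], [cond_exp1] is a constant. Hence a finite norm of
    [cond_exp] yields its square integrability even before [Y] is known to be
    integrable. *)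
Lemma measurable_cond_exp1 (Y : Omega -> R) : measurable_wrt G (cond_exp1 P G Y).
Proof.
rewrite /cond_exp1; case: xgetP => [Z _ [] //|_].
by apply/measurable_wrtP => //; exact: measurable_cst.
Qed.

Lemma cond_expE d (Y : Omega -> 'rV[R]_d) i :
  (fun w => cond_exp P G Y w 0 i) = cond_exp1 P G (fun w => Y w 0 i).
Proof. by apply/funext => w; rewrite mxE. Qed.

Lemma measurable_cond_exp d (Y : Omega -> 'rV[R]_d) :
  measurable_wrtV G (cond_exp P G Y).
Proof. move=> i; rewrite cond_expE; exact: measurable_cond_exp1. Qed.

(** [V - C] is orthogonal to every [G]-measurable square integrable vector, in
    particular to [C] itself. *)
Lemma pythagoras d (V C : Omega -> 'rV[R]_d) :
  sq_integrable P V -> sq_integrable P C -> measurable_wrtV G C ->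
  (forall i A, G A -> (\int[P]_(w in A) (C w 0 i)%:E =
                       \int[P]_(w in A) (V w 0 i)%:E)%E) ->
  l2_inner P V V =
  l2_inner P C C + l2_inner P (fun w => V w - C w) (fun w => V w - C w).
Proof.
move=> hV hC mC CV; have hVC := sq_integrableB hV hC.
have crossE : \int[P]_w dot (C w) (V w - C w) = 0.
  rewrite /Rintegral.
  transitivity (fine (\int[P]_w \sum_(i < d) (C w 0 i * (V w - C w) 0 i)%:E)%E).
    by congr fine; apply: eq_integral => w _; rewrite sumEFin.
  rewrite integral_sum //; last by move=> i; exact: Lfun2_mul.
  rewrite big1 // => i _.
  rewrite integral_EFin_Rintegral; last exact: Lfun2_mul.
  rewrite integral_mul_wrt //; move=> A GA.
    have mA := GM GA.
    under eq_integral do rewrite !mxE EFinB.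
    have iC :=
      integrableS measurableT mA (@subsetT _ _) (Lfun2_integrable1 (hC i)).
    have iV :=
      integrableS measurableT mA (@subsetT _ _) (Lfun2_integrable1 (hV i)).
    rewrite integralB //.
    by rewrite CV // subee //; exact: integrable_fin_num.
have i1 := dot_integrable hC hC; have i2 := dot_integrable hVC hVC.
have i3 := dot_integrable hC hVC.
rewrite -[RHS]addr0 -[X in _ + X](mulr0 2) -[X in _ = _ + 2 * X]crossE.
rewrite /l2_inner.
rewrite -RintegralD // -RintegralZl // -RintegralD //.
- apply: eq_Rintegral => w _; rewrite /dot mulr_sumr -!big_split/=.
  by apply: eq_bigr => i _; rewrite !mxE; ring.
- exact: (integrableD measurableT i1 i2).
- exact: (integrableZl measurableT 2 i3).
Qed.

(** The conditional mean and the fluctuation of [D + S] are orthogonal, so Young's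
    inequality may be applied to them with different weights. For the mean, the
    weight [delta] costs [S] a factor [1 + delta], harmless over a step of size
    [delta], while [D] pays [1 / delta]. For the fluctuation, the weight
    [eta - 1] makes the factor of [S] exactly the [eta] that C-stability
    controls, and [D] pays only a constant. *)
Lemma error_split d (D S : Omega -> 'rV[R]_d) (delta eta : R) :
  0 < delta -> 1 < eta ->
  sq_integrable P D -> sq_integrable P S ->
  sq_integrable P (cond_exp P G D) -> sq_integrable P (cond_exp P G S) ->
  l2_inner P (fun w => D w + S w) (fun w => D w + S w) <=
  (1 + delta) * l2_inner P (cond_exp P G S) (cond_exp P G S)
  + (1 + delta^-1) * l2_inner P (cond_exp P G D) (cond_exp P G D)
  + (eta * l2_inner P (id_sub_cond_exp P G S) (id_sub_cond_exp P G S)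
     + eta / (eta - 1) *
       l2_inner P (id_sub_cond_exp P G D) (id_sub_cond_exp P G D)).
Proof.
move=> d0 eta1 hD hS hcD hcS.
have hC := sq_integrableD hcS hcD.
rewrite (pythagoras (C := fun w => cond_exp P G S w + cond_exp P G D w)).
- apply: lerD; first exact: l2_inner_Young.
  have -> : (fun w => D w + S w - (cond_exp P G S w + cond_exp P G D w)) =
      (fun w => id_sub_cond_exp P G S w + id_sub_cond_exp P G D w).
    apply/funext => w; rewrite /id_sub_cond_exp.
    by rewrite [D w + _]addrC opprD addrACA.
  have -> : eta = 1 + (eta - 1) by ring.
  have -> : (1 + (eta - 1)) / (1 + (eta - 1) - 1) = 1 + (eta - 1)^-1.
    by field; lra.
  by apply: l2_inner_Young; [lra|exact: sq_integrableB..].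
- exact: sq_integrableD.
- exact: hC.
- move=> i; apply/measurable_wrtP => //.
  rewrite (_ : (fun _ => _) =
      fun w => cond_exp P G S w 0 i + cond_exp P G D w 0 i).
    apply: measurable_funD; apply/measurable_wrtP => //;
      exact: measurable_cond_exp.
  by apply/funext => w; rewrite mxE.
- move=> i A GA; have mA := GM GA.
  have [iD icD _ eD] := cond_exp1P (Lfun2_integrable1 (hD i)).
  have [iS icS _ eS] := cond_exp1P (Lfun2_integrable1 (hS i)).
  have AT : A `<=` setT by [].
  under eq_integral do rewrite !mxE EFinD.
  under [RHS]eq_integral do rewrite !mxE EFinD.
  rewrite !integralD //; try exact: (integrableS measurableT mA AT).
  by rewrite eD // eS // addeC.
Qed.

End orthogonality.

(** * The initial value of the exact solution *)

Section initial.
Context (R : realType) (disp : measure_display) (Omega : measurableType disp)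
        (P : probability Omega R) (T : R) (F : R -> set (set Omega)).
Hypothesis T0 : 0 < T.
Hypothesis uF : usual_conditions P T F.

Lemma zero_in_horizon : (0 : R) \in `[0, T].
Proof. by rewrite in_itv/= lexx ltW. Qed.

Lemma sp_integral0 (H : simple_process R Omega) (W : R -> Omega -> R) w :
  is_simple T F H -> sp_integral H W 0 w = 0.
Proof.
case=> H0 Hmon _ _.
have Hge0 j : (j <= sp_size H)%N -> 0 <= sp_time H j.
  elim: j => // j IH jH; exact: le_trans (IH (ltnW jH)) (Hmon _ jH).
rewrite /sp_integral big1 // => j _.
by rewrite !min_r ?subrr ?mulr0 //; apply: Hge0 => //; exact: ltnW.
Qed.

(** The elementary integrals vanish at time 0, and a limit in probability of the
    zero variable is almost surely zero. *)
Lemma ito_integral0 (W G I : R -> Omega -> R) :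
  ito_integral P T F W G I -> {ae P, forall w, I 0 w = 0}.
Proof.
case=> aI _ [H [sH _ cH]].
have [FM _ _ _ _] := uF.
have mI : measurable_fun setT (I 0).
  exact: (measurable_wrt_fun (FM _ zero_in_horizon).2 (aI _ zero_in_horizon)).
have mA e : measurable [set w | e <= `|I 0 w|].
  rewrite -[X in measurable X]setTI.
  have -> : [set w | e <= `|I 0 w|] =
      (fun w => `|I 0 w|) @^-1` `[e, +oo[%classic.
    by apply/seteqP; split => w /=; rewrite in_itv/= andbT.
  by apply: (measurableT_comp (@normr_measurable R setT) mI).
have I0 (e : R) : 0 < e -> P [set w | e <= `|I 0 w|] = 0%E.
  move=> e0; have := cH _ zero_in_horizon _ e0.
  rewrite (_ : (fun n => P _) = cst (P [set w | e <= `|I 0 w|])).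
    by move=> /cvg_lim <- //; rewrite lim_cst.
  apply/funext => n /=; congr (P _); apply/seteqP; split => w /=;
    by rewrite sp_integral0 // sub0r normrN.
have /negligibleS : P.-negligible (\bigcup_k [set w | k.+1%:R^-1 <= `|I 0 w|]).
  apply: negligible_bigcup => k; apply/negligibleP => //.
  exact: I0.
apply => w /= /eqP Iw.
have Ipos : 0 < `|I 0 w| by rewrite normr_gt0.
exists (Num.bound `|I 0 w|^-1) => //=.
rewrite invf_ple ?posrE // ltW //.
apply: (lt_le_trans (archi_boundP _)); first by rewrite invr_ge0.
by rewrite ler_nat.
Qed.

(** The initial value enters only through the integral equation, which at time 0
    reduces to [X 0 = X0] because both integrals vanish there. *)
Lemma exact_solution0 (d m : nat) (W : 'I_m -> R -> Omega -> R)
    (f : R -> 'rV[R]_d -> 'rV[R]_d) (g : 'I_m -> R -> 'rV[R]_d -> 'rV[R]_d)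
    (X0 : Omega -> 'rV[R]_d) (X : R -> Omega -> 'rV[R]_d) :
  exact_solution P T F W f g X0 X -> {ae P, forall w, X 0 w = X0 w}.
Proof.
case=> _ _ [I [Iito XE]].
have I0 : {ae P, forall w, forall r i, I r i 0 w = 0}.
  apply: filter_forall => r; apply: filter_forall => i.
  exact: ito_integral0 (Iito r i).
apply: filterS2 XE I0 => w Xw Iw.
apply/rowP => i; rewrite (Xw _ zero_in_horizon) set_itv1 Rintegral_set1 addr0.
by rewrite big1 ?addr0.
Qed.

End initial.

(** * The error over one step *)

Section scheme.
Context (R : realType) (T hbar Cstab Ccons eta : R).
Hypotheses (T0 : 0 < T) (hbarT : 0 < hbar <= T) (eta1 : 1 < eta).

(** Gronwall exponent: [(1 + delta) (1 + Cstab delta) <= exp (growth_rate delta)].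
    The absolute value allows for a negative [Cstab]. *)
Definition growth_rate : R := 1 + `|Cstab|.
(** The squared local errors [(Ccons delta^(gamma+1))^2] and
    [(Ccons delta^(gamma+1/2))^2], weighted by [1 + 1 / delta] and
    [eta / (eta - 1)], add up to at most [local_const delta (delta^gamma)^2]
    when [delta <= T]. *)
Definition local_const : R := Ccons ^+ 2 * (1 + T + eta / (eta - 1)).

Lemma eta_ratio_ge0 : 0 <= eta / (eta - 1).
Proof.
have eta_ge0 : 0 <= eta := ltW (lt_trans ltr01 eta1).
by rewrite divr_ge0 // subr_ge0 ltW.
Qed.

Lemma local_const_ge0 : 0 <= local_const.
Proof.
have e0 := eta_ratio_ge0.
apply: mulr_ge0; first exact: sqr_ge0.
by apply: addr_ge0 e0; apply: addr_ge0; [exact: ler01 | exact: ltW].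
Qed.

(** Here [q] stands for [delta^gamma], [a] and [b] for the squared norms of the
    conditional mean and of the fluctuation of the propagated error, [u] and [v]
    for those of the local error, and [E] for the squared error at the start of
    the step. *)
Lemma scalar_step (delta q a b u v E : R) :
  0 < delta -> delta <= T -> 0 <= a -> 0 <= b -> 0 <= E ->
  a + eta * b <= (1 + Cstab * delta) * E ->
  u <= (Ccons * (q * delta)) ^+ 2 ->
  v <= (Ccons * (q * Num.sqrt delta)) ^+ 2 ->
  (1 + delta) * a + (1 + delta^-1) * u + (eta * b + eta / (eta - 1) * v) <=
  expR (growth_rate * delta) * E + local_const * delta * q ^+ 2.
Proof.
move=> d0 dT a0 b0 E0 abE uq vq.
have eta0 := eta_ratio_ge0.
have u' : (1 + delta^-1) * u <= Ccons ^+ 2 * q ^+ 2 * (delta * (1 + delta)).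
  have di : 0 <= 1 + delta^-1 by rewrite addr_ge0 // invr_ge0 ltW.
  apply: (le_trans (ler_wpM2l di uq)).
  by rewrite le_eqVlt; apply/orP; left; apply/eqP; field; rewrite gt_eqF.
have v' : eta / (eta - 1) * v <= eta / (eta - 1) * (Ccons ^+ 2 * q ^+ 2 * delta).
  apply: ler_wpM2l => //; apply: (le_trans vq).
  by rewrite !exprMn (sqr_sqrtr (ltW d0)) mulrA.
have ab' : (1 + delta) * a + eta * b <= expR (growth_rate * delta) * E.
  have etab : 0 <= eta * b by rewrite mulr_ge0 // ltW // (lt_trans ltr01).
  apply: (@le_trans _ _ ((1 + delta) * (a + eta * b))).
    by rewrite mulrDr lerD2l mulrDl mul1r lerDl mulr_ge0 // ltW.
  apply: (@le_trans _ _ ((1 + delta) * ((1 + Cstab * delta) * E))).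
    by apply: ler_wpM2l => //; lra.
  rewrite mulrA; apply: ler_wpM2r => //.
  rewrite /growth_rate [X in expR X]mulrDl mul1r expRD.
  apply: (@le_trans _ _ ((1 + delta) * expR (`|Cstab| * delta))).
    apply: ler_wpM2l; first by lra.
    apply: (le_trans _ (expR_ge1Dx _)); rewrite lerD2l.
    by apply: ler_wpM2r; [exact: ltW | exact: ler_norm].
  by apply: ler_wpM2r; [exact: expR_ge0 | exact: expR_ge1Dx].
have dd : Ccons ^+ 2 * q ^+ 2 * (delta * (1 + delta)) <=
    Ccons ^+ 2 * q ^+ 2 * (delta * (1 + T)).
  apply: ler_wpM2l; first by rewrite mulr_ge0 ?sqr_ge0.
  by apply: ler_wpM2l; [exact: ltW | lra].
have -> : local_const * delta * q ^+ 2 =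
    Ccons ^+ 2 * q ^+ 2 * (delta * (1 + T)) +
    eta / (eta - 1) * (Ccons ^+ 2 * q ^+ 2 * delta).
  by rewrite /local_const; ring.
lra.
Qed.

Context (d : nat) (disp : measure_display) (Omega : measurableType disp)
    (P : probability Omega R) (F : R -> set (set Omega))
    (X : R -> Omega -> 'rV[R]_d)
    (Psi : 'rV[R]_d -> R -> R -> Omega -> 'rV[R]_d) (xi : Omega -> 'rV[R]_d)
    (gamma : R).
Hypothesis uF : usual_conditions P T F.
Hypothesis aX : forall i, adapted T F (fun t w => X t w 0 i).
Hypothesis osm : one_step_method P T F Psi hbar xi.
Hypothesis stab : C_stable P T F Psi hbar Cstab eta.
Hypothesis cons : B_consistent P T F Psi hbar X gamma Ccons.

(** The new error is the local error [D] of the exact solution plus the propagated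
    error [S]. Square integrability of the exact solution is also carried over
    the step: [X (t + delta)] is the sum of [D], which has a finite norm by
    B-consistency, and of [Psi] applied to the square integrable [X t]. *)
Lemma local_step (t delta : R) (Z : Omega -> 'rV[R]_d) :
  admissible T hbar t delta -> inLp P 2 (F t) (X t) -> inLp P 2 (F t) Z ->
  let e Y : Omega -> 'rV[R]_d :=
    fun w => X (t + delta) w - one_step Psi Y t delta w in
  inLp P 2 (F (t + delta)) (X (t + delta)) /\
  l2_inner P (e Z) (e Z) <=
    expR (growth_rate * delta) *
      l2_inner P (fun w => X t w - Z w) (fun w => X t w - Z w)
    + local_const * delta * (delta `^ gamma) ^+ 2.
Proof.
move=> adm hX hZ e; have [/andP[t0 tT] /andP[d0 dh] tdT] := adm.
have [_ hT] := andP hbarT.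
have [FM _ _ _ _] := uF.
have tin : t \in `[0, T] by rewrite in_itv/= t0 ltW.
have tdin : t + delta \in `[0, T] by rewrite in_itv/= tdT addr_ge0 // ltW.
have [sFt FtM] := FM _ tin; have [sFtd FtdM] := FM _ tdin.
have sX := inLp2_sq_integrable FtM hX; have sZ := inLp2_sq_integrable FtM hZ.
have sPX := inLp2_sq_integrable FtdM (osm.2 _ _ _ adm hX).
have sPZ := inLp2_sq_integrable FtdM (osm.2 _ _ _ adm hZ).
pose D : Omega -> 'rV[R]_d := e (X t).
pose S : Omega -> 'rV[R]_d :=
  fun w => one_step Psi (X t) t delta w - one_step Psi Z t delta w.
have mfun_sq (Y : Omega -> 'rV[R]_d) : sq_integrable P Y ->
    forall i, measurable_fun setT (fun w => Y w 0 i).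
  by move=> hY i; have /Lfun2P[] := hY i.
have mcond (Y : Omega -> 'rV[R]_d) i :
    measurable_fun setT (fun w => cond_exp P (F t) Y w 0 i).
  exact: (measurable_wrt_fun FtM (measurable_cond_exp P sFt Y i)).
have midsub (Y : Omega -> 'rV[R]_d) :
    (forall i, measurable_fun setT (fun w => Y w 0 i)) ->
    forall i, measurable_fun setT (fun w => id_sub_cond_exp P (F t) Y w 0 i).
  move=> mY i.
  rewrite (_ : (fun _ => _) = fun w => Y w 0 i - cond_exp P (F t) Y w 0 i).
    exact: measurable_funB.
  by apply/funext => w; rewrite !mxE.
have mXtd i : measurable_fun setT (fun w => X (t + delta) w 0 i).
  exact: (measurable_wrt_fun FtdM (aX i tdin)).
have mD i : measurable_fun setT (fun w => D w 0 i).
  rewrite (_ : (fun _ => _) =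
      fun w => X (t + delta) w 0 i - one_step Psi (X t) t delta w 0 i).
    by apply: measurable_funB => //; exact: mfun_sq.
  by apply/funext => w; rewrite !mxE.
have [consE consV] := cons adm.
have scD : sq_integrable P (cond_exp P (F t) D).
  by apply: finite_norm_sq_integrable => //; exact: le_lt_trans consE (ltry _).
have siD : sq_integrable P (id_sub_cond_exp P (F t) D).
  apply: finite_norm_sq_integrable; first exact: midsub.
  exact: le_lt_trans consV (ltry _).
have sD : sq_integrable P D.
  have := sq_integrableD scD siD.
  rewrite (_ : (fun _ => _) = D) //.
  by apply/funext => w; rewrite /id_sub_cond_exp addrC subrK.
have sXtd : sq_integrable P (X (t + delta)).
  have := sq_integrableD sD sPX.
  rewrite (_ : (fun _ => _) = X (t + delta)) //.
  by apply/funext => w; rewrite /D /e subrK.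
split.
  by apply: sq_integrable_inLp2 => // i; exact: aX.
have sS : sq_integrable P S := sq_integrableB sPX sPZ.
have := stab adm hX hZ; cbv zeta.
rewrite -/S (normLp2_sqr (sq_integrableB sX sZ)) -EFinM => stabS.
have [cSoo iSoo] : (normLp P 2 (cond_exp P (F t) S) < +oo)%E /\
    (normLp P 2 (id_sub_cond_exp P (F t) S) < +oo)%E.
  by apply: lty_of_sum_sqr stabS; [exact: lt_trans eta1|exact: Lnorm_ge0..].
have scS : sq_integrable P (cond_exp P (F t) S).
  exact: finite_norm_sq_integrable.
have siS : sq_integrable P (id_sub_cond_exp P (F t) S).
  by apply: finite_norm_sq_integrable => //; apply: midsub; exact: mfun_sq.
move: stabS; rewrite !normLp2_sqr // -EFinM -EFinD lee_fin => stabS.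
have dne : delta != 0 by rewrite gt_eqF.
have powE (s : R) : 0 < s -> delta `^ (gamma + s) = delta `^ gamma * delta `^ s.
  by move=> s0; rewrite powRD // dne implybT.
move: (normLp2_le scD consE) (normLp2_le siD consV).
rewrite !powE // ?powRr1 ?powR12_sqrt ?(ltW d0) ?invr_gt0 // => cE cV.
have -> : e Z = fun w => D w + S w.
  by apply/funext => w; rewrite /e /D /S addrA subrK.
apply: (le_trans (error_split sFt FtM d0 eta1 sD sS scD scS)).
apply: scalar_step => //; try exact: l2_inner_ge0.
exact: le_trans dh hT.
Qed.

End scheme.

(** * Grids *)

Section grid.
Context (R : realType) (T hbar : R) (N : nat) (h : N.-tuple R).
Hypothesis hh : step_sizes T hbar h.

Lemma grid_pointS n : grid_point h n.+1 = grid_point h n + h`_n.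
Proof. by rewrite /grid_point big_ord_recr. Qed.

Lemma step_bounds n : (n < N)%N -> 0 < h`_n <= hbar.
Proof. by move=> nN; have := hh.1 (Ordinal nN); rewrite (tnth_nth 0). Qed.

Lemma grid_point_end : grid_point h N = T.
Proof. by rewrite -hh.2; apply: eq_bigr => i _; rewrite (tnth_nth 0). Qed.

Lemma grid_point_mono n k :
  (n + k <= N)%N -> grid_point h n <= grid_point h (n + k).
Proof.
elim: k => [|k IH]; first by rewrite addn0.
rewrite addnS => nkN; rewrite grid_pointS.
have /andP[hk _] := step_bounds nkN.
by apply: (le_trans (IH (ltnW nkN))); rewrite lerDl ltW.
Qed.

Lemma grid_point_le n : (n <= N)%N -> grid_point h n <= T.
Proof.
move=> nN; have := @grid_point_mono n (N - n).
by rewrite subnKC // grid_point_end => ->.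
Qed.

Lemma grid_point_ge0 n : (n <= N)%N -> 0 <= grid_point h n.
Proof.
move=> nN; rewrite (_ : 0 = grid_point h 0) ?(@grid_point_mono 0) //.
by rewrite /grid_point big_ord0.
Qed.

Lemma admissible_step n : (n < N)%N -> admissible T hbar (grid_point h n) h`_n.
Proof.
move=> nN; have /andP[h0 hb] := step_bounds nN.
have := grid_point_le nN; rewrite grid_pointS => le_T.
split; [|by rewrite h0|by []].
by rewrite grid_point_ge0 1?ltnW //= (lt_le_trans _ le_T) // ltrDl.
Qed.

Lemma step_le_max n : (n < N)%N -> h`_n <= max_step h.
Proof.
move=> nN; have -> : h`_n = tnth h (Ordinal nN) by rewrite (tnth_nth 0).
exact: (le_bigmax _ (fun i => tnth h i)).
Qed.

End grid.

(** * The global error *)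

Section global.
Context (R : realType) (T hbar Cstab Ccons eta : R).
Hypotheses (T0 : 0 < T) (hbarT : 0 < hbar <= T) (eta1 : 1 < eta).
Context (d : nat) (disp : measure_display) (Omega : measurableType disp)
    (P : probability Omega R) (F : R -> set (set Omega))
    (X : R -> Omega -> 'rV[R]_d)
    (Psi : 'rV[R]_d -> R -> R -> Omega -> 'rV[R]_d) (xi : Omega -> 'rV[R]_d)
    (gamma : R).
Hypothesis uF : usual_conditions P T F.
Hypothesis aX : forall i, adapted T F (fun t w => X t w 0 i).
Hypothesis osm : one_step_method P T F Psi hbar xi.
Hypothesis stab : C_stable P T F Psi hbar Cstab eta.
Hypothesis gamma0 : 0 < gamma.
Hypothesis cons : B_consistent P T F Psi hbar X gamma Ccons.
Hypothesis X_xi : {ae P, forall w, X 0 w = xi w}.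

Local Notation K := (local_const T Ccons eta).
Local Notation c := (growth_rate Cstab).

(** Discrete Gronwall: each step multiplies the squared error by at most
    [exp (c h_n)] and adds [K h_n] times the squared maximal local rate. The
    exponentials multiply to [exp (c t)] and the step sizes sum to [t], whence
    the form of the bound. Square integrability of the exact and of the numerical
    solution is part of the induction, as the hypotheses at the next step
    presuppose it. *)
Lemma error_recursion (N : nat) (h : N.-tuple R) (n : nat) :
  step_sizes T hbar h -> (n <= N)%N ->
  let t := grid_point h n in
  let e : Omega -> 'rV[R]_d := fun w => X t w - grid_function Psi xi h n w in
  [/\ inLp P 2 (F t) (X t), inLp P 2 (F t) (grid_function Psi xi h n) &
      l2_inner P e e <= K * (max_step h `^ gamma) ^+ 2 * expR (c * t) * t].
Proof.
move=> hh; elim: n => [_|n IH nN].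
  have [FM _ _ _ _] := uF; have [_ F0M] := FM _ (zero_in_horizon T0).
  rewrite /= /grid_point big_ord0.
  have [xi2 _] := osm; have mxi i := measurable_wrt_fun F0M (xi2.1 i).
  have mX i : measurable_fun setT (fun w => X 0 w 0 i).
    exact: (measurable_wrt_fun F0M (aX i (zero_in_horizon T0))).
  split => //.
  - split; first by move=> i; exact: (aX i (zero_in_horizon T0)).
    by rewrite (ae_eq_normLp2 mX mxi X_xi) xi2.2.
  - rewrite mulr0 /l2_inner /Rintegral.
    rewrite (ae_eq_integral (cst 0%E)) ?integral0 //.
    + apply/measurable_EFinP; apply: measurable_sum => i.
      have mB : measurable_fun setT (fun w => (X 0 w - xi w) 0 i).
        rewrite (_ : (fun _ => _) = fun w => X 0 w 0 i - xi w 0 i).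
          exact: measurable_funB.
        by apply/funext => w; rewrite !mxE.
      exact: measurable_funM.
    + apply: filterS X_xi => w Xw _ /=; rewrite Xw subrr /dot.
      by rewrite big1 // => i _; rewrite mxE mul0r.
have [hX hZ eIH] := IH (ltnW nN).
have adm := admissible_step hh nN.
have [Xn en] := local_step hbarT eta1 uF aX osm stab cons adm hX hZ.
rewrite /= grid_pointS; split => //.
  exact: osm.2 adm hZ.
apply: (le_trans en) => {en}.
set t := grid_point h n in eIH *; set M := max_step h `^ gamma in eIH *.
have [/andP[t0 _] /andP[d0 _] _] := adm; rewrite -/t in t0.
have K0 : 0 <= K := local_const_ge0 Ccons T0 eta1.
have M0 : 0 <= M := powR_ge0 _ _.
have c0 : 0 <= c by rewrite /growth_rate addr_ge0.
have dM : (h`_n `^ gamma) ^+ 2 <= M ^+ 2.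
  rewrite lerXn2r ?nnegrE ?powR_ge0 //.
  rewrite ge0_ler_powR ?nnegrE ?(ltW d0) ?(ltW gamma0) //.
    by rewrite (le_trans (ltW d0)) // step_le_max.
  exact: step_le_max.
rewrite (mulrDr c) expRD.
apply: (@le_trans _ _ (expR (c * h`_n) * (K * M ^+ 2 * expR (c * t) * t) +
    K * h`_n * M ^+ 2)).
  apply: lerD; first by rewrite ler_wpM2l ?expR_ge0.
  by rewrite ler_wpM2l // mulr_ge0 // ltW.
have ge1 : 1 <= expR (c * t) * expR (c * h`_n).
  rewrite -expRD -mulrDr; apply: (le_trans _ (expR_ge1Dx _)).
  by rewrite lerDl mulr_ge0 // addr_ge0 // ltW.
have : K * h`_n * M ^+ 2 <=
    K * h`_n * M ^+ 2 * (expR (c * t) * expR (c * h`_n)).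
  by rewrite ler_peMr // mulr_ge0 ?sqr_ge0 // mulr_ge0 // ltW.
move=> le1; apply: (le_trans (lerD (lexx _) le1)).
by rewrite le_eqVlt; apply/orP; left; apply/eqP; ring.
Qed.

Lemma global_error (N : nat) (h : N.-tuple R) :
  step_sizes T hbar h ->
  (\big[maxe/-oo]_(n < N.+1)
     normLp P 2 (fun w => X (grid_point h n) w - grid_function Psi xi h n w)%R
   <= (Num.sqrt (K * expR (c * T) * T) * max_step h `^ gamma)%:E)%E.
Proof.
move=> hh; apply: bigmax_le => [|n _]; first exact: leNye.
have nN : (n <= N)%N by rewrite -ltnS.
have [hX hZ en] := error_recursion hh nN.
have t0 := grid_point_ge0 hh nN; have tT := grid_point_le hh nN.
have [FM _ _ _ _] := uF.
have tin : grid_point h n \in `[0, T] by rewrite in_itv/= t0.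
have [_ FtM] := FM _ tin.
rewrite normLp2_l2_inner; last first.
  by apply: sq_integrableB; apply: inLp2_sq_integrable FtM _.
have K0 : 0 <= K := local_const_ge0 Ccons T0 eta1.
have M0 : 0 <= max_step h `^ gamma := powR_ge0 _ _.
have c0 : 0 <= c by rewrite /growth_rate addr_ge0.
rewrite lee_fin -[X in _ <= _ * X](ger0_norm M0) -sqrtr_sqr -sqrtrM; last first.
  exact: mulr_ge0 (mulr_ge0 K0 (expR_ge0 _)) (ltW T0).
apply: ler_wsqrtr; apply: (le_trans en).
have expt : expR (c * grid_point h n) * grid_point h n <= expR (c * T) * T.
  by apply: ler_pM => //; rewrite ?expR_ge0 // ler_expR ler_wpM2l.
have := ler_wpM2l (mulr_ge0 K0 (sqr_ge0 (max_step h `^ gamma))) expt.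
rewrite mulrA => /le_trans; apply.
by rewrite le_eqVlt; apply/orP; left; apply/eqP; ring.
Qed.

End global.

Unset Implicit Arguments.

Theorem theorem3p7 (R : realType) (T hbar Cstab Ccons eta : R)
    (hT : 0 < T) (hhbar : 0 < hbar <= T) (heta : 1 < eta) :
  exists C : R,
  forall (d m : nat) (disp : measure_display) (Omega : measurableType disp)
    (P : probability Omega R) (F : R -> set (set Omega))
    (W : 'I_m -> R -> Omega -> R)
    (f : R -> 'rV[R]_d -> 'rV[R]_d) (g : 'I_m -> R -> 'rV[R]_d -> 'rV[R]_d)
    (p : R) (X0 : Omega -> 'rV[R]_d) (X : R -> Omega -> 'rV[R]_d)
    (Psi : 'rV[R]_d -> R -> R -> Omega -> 'rV[R]_d) (xi : Omega -> 'rV[R]_d)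
    (gamma : R),
    (0 < d)%N -> (0 < m)%N ->
    usual_conditions P T F ->
    independent_brownian_motions P T F W ->
    2 <= p -> inLp P p (F 0) X0 ->
    sode_coefficients T f g ->
    exact_solution P T F W f g X0 X ->
    one_step_method P T F Psi hbar xi ->
    C_stable P T F Psi hbar Cstab eta ->
    0 < gamma ->
    B_consistent P T F Psi hbar X gamma Ccons ->
    {ae P, forall w, xi w = X0 w} ->
    (forall (N : nat) (h : N.-tuple R), step_sizes T hbar h ->
       (\big[maxe/-oo]_(n < N.+1)
          normLp P 2 (fun w =>
            X (grid_point h n) w - grid_function Psi xi h n w)%R
        <= (C * max_step h `^ gamma)%:E)%E) /\
    strongly_convergent P T Psi hbar xi X gamma.
Proof.
exists (Num.sqrt (local_const T Ccons eta * expR (growth_rate Cstab * T) * T)).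
move=> d m disp Omega P F W f g p X0 X Psi xi gamma _ _ uF _ _ _ _ solX osm
  stab gamma0 cons xiX0.
have X_xi : {ae P, forall w, X 0 w = xi w}.
  by apply: filterS2 (exact_solution0 hT uF solX) xiX0 => w -> ->.
have [aX _ _] := solX.
have bound := @global_error R T hbar Cstab Ccons eta hT hhbar heta
  d disp Omega P F X Psi xi gamma uF aX osm stab gamma0 cons X_xi.
split=> //.
eexists => N h hh.
under eq_bigr do rewrite normLp2_distrC.
exact: bound hh.
Qed.
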